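(* Let $\varphi$ be an Orlicz $N$-function with Young–Fenchel transform $\psi$ and let $q_\varphi$ be the generalized inverse of the density of $\varphi$. Let $\{X_{k,n}, k\ge1,n\ge1\}$ be a double array of $\varphi$-subgaussian random variables, and let $g$ be a positive non-decreasing function such that for all $k,n\ge1$ $$\tau_\varphi(X_{k,n})\le g(\ln(kn)).$$ Set $a_{m,j}=g(\ln(mj))\,\psi^{-1}(\ln(mj))$, $Y_{m,j}=\max_{1\le k\le m,1\le n\le j}X_{k,n}-a_{m,j}$ and $Y^+_{m,j}=\max(Y_{m,j},0)$. Suppose there exists $\varepsilon_0>0$ such that for every $\varepsilon\in(0,\varepsilon_0]$ $$\int_0^\infty \psi(x)\,q_\varphi(x)\exp\left(-\frac{\varepsilon\, q_\varphi(x)}{g(\psi(x)+\ln 2)}\right)dx<+\infty.$$ Then $\lim_{m\vee j\to\infty}Y^+_{m,j}=0$ almost surely.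
   Context: An Orlicz $N$-function is a continuous even convex function $\varphi:\mathbb R\to\mathbb R$ with $\varphi(0)=0$, increasing on $(0,\infty)$, with $\varphi(x)/x\to0$ as $x\to0$ and $\varphi(x)/x\to+\infty$ as $x\to+\infty$. It can be written $\varphi(x)=\int_0^{|x|}p_\varphi(t)\,dt$ with non-decreasing density $p_\varphi$; its generalized inverse is $q_\varphi(t)=\sup\{u\ge0:p_\varphi(u)\le t\}$. The Young–Fenchel transform is $\psi(x)=\sup_{y\in\mathbb R}(xy-\varphi(y))$; it is an Orlicz $N$-function with $\psi(x)=\int_0^{|x|}q_\varphi(t)\,dt$, and $\psi^{-1}$ denotes the inverse of $\psi$ restricted to $[0,\infty)$. A random variable $X$ is $\varphi$-subgaussian if $EX=0$ and there is a finite $a>0$ with $E\exp(tX)\le\exp(\varphi(at))$ for all $t\in\mathbb R$; its $\varphi$-subgaussian norm is $\tau_\varphi(X)=\inf\{a>0:E\exp(tX)\le\exp(\varphi(at))\ \forall t\in\mathbb R\}$. For a double array $b_{m,j}$, $\lim_{m\vee j\to\infty}b_{m,j}=b$ means: for every $\varepsilon>0$ there is $N$ such that $|b_{m,j}-b|<\varepsilon$ whenever $\max(m,j)\ge N$. *)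

(* Defs.v *)
From HB Require Import structures.
From mathcomp Require Import all_boot all_order all_algebra.
From mathcomp Require Import all_classical all_reals all_analysis.
Set Implicit Arguments. Unset Strict Implicit. Unset Printing Implicit Defensive.
Import Order.TTheory GRing.Theory Num.Theory.
Import numFieldNormedType.Exports.
Local Open Scope classical_set_scope.
Local Open Scope ring_scope.

Section Orlicz.
Variable R : realType.

Definition N_function (phi : R -> R) : Prop :=
  continuous phi /\
  (forall x, phi (- x) = phi x) /\
  (forall x y t, 0 <= t -> t <= 1 ->
      phi (t * x + (1 - t) * y) <= t * phi x + (1 - t) * phi y) /\
  phi 0 = 0 /\
  (forall x y, 0 < x -> x < y -> phi x < phi y) /\
  (phi x / x @[x --> 0^'+] --> 0) /\
  (phi x / x @[x --> +oo] --> +oo).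

Definition is_density (phi p : R -> R) : Prop :=
  (forall s t, s <= t -> p s <= p t) /\
  (forall x, ((phi x)%:E =
     \int[lebesgue_measure]_(t in `[0%R, `|x|%R]) (p t)%:E)%E).

Definition gen_inv (p : R -> R) (t : R) : R :=
  sup [set u | 0 <= u /\ p u <= t].

Definition young (phi : R -> R) (x : R) : R :=
  sup (range (fun y => x * y - phi y)).

Definition inv_pos (psi : R -> R) (v : R) : R :=
  sup [set u | 0 <= u /\ psi u <= v].

Definition mgf_bound {d} {T : measurableType d} (P : probability T R)
  (phi : R -> R) (X : T -> R) (a : R) : Prop :=
  forall t : R, (\int[P]_w (expR (t * X w))%:E <= (expR (phi (a * t)))%:E)%E.

Definition subgaussian {d} {T : measurableType d} (P : probability T R)
  (phi : R -> R) (X : T -> R) : Prop :=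
  (\int[P]_w (X w)%:E = 0)%E /\ exists a, 0 < a /\ mgf_bound P phi X a.

Definition tau {d} {T : measurableType d} (P : probability T R)
  (phi : R -> R) (X : T -> R) : R :=
  inf [set a | 0 < a /\ mgf_bound P phi X a].

(* max_{1<=k<=m, 1<=n<=j} X k n w  (for m, j >= 1) *)
Definition max_array {T} (X : nat -> nat -> T -> R) (m j : nat) (w : T) : R :=
  \big[Num.max/X 1%N 1%N w]_(1 <= k < m.+1)
     \big[Num.max/X 1%N 1%N w]_(1 <= n < j.+1) X k n w.

Definition dlim (b : nat -> nat -> R) (b0 : R) : Prop :=
  forall eps, 0 < eps -> exists N : nat, forall m j : nat,
    (0 < m)%N -> (0 < j)%N -> (N <= maxn m j)%N -> `|b m j - b0| < eps.

End Orlicz.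

(* Main.v *)
Require Import Defs.
From HB Require Import structures.
From mathcomp Require Import all_boot all_order all_algebra.
From mathcomp Require Import all_classical all_reals all_analysis.
From mathcomp Require Import measurable_realfun ring lra zify.
Import Order.TTheory GRing.Theory Num.Theory.
Import numFieldNormedType.Exports.
Local Open Scope classical_set_scope.
Local Open Scope ring_scope.

(* For kn = N put u_N = psi^-1(ln N).  Chernoff's bound at the slope
   q(u_N) / g(ln N), where Young's inequality is an equality, gives
     P(X_{k,n} >= a_{k,n} + eps) <= N^-1 exp(- eps q(u_N) / g(ln N)).
   There are d(N) pairs (k, n) with kn = N.  Since psi increases by ln 2 on
   [psi^-1(ln N - ln 2), u_N], each term with N >= 4 is at most
     (ln 2)^-1 (d(N)/N) int q(x) exp(- eps q(x) / g(psi(x) + ln 2)) dx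
   over that interval.  A point x lies in it only if
   exp(psi x) <= N <= 2 exp(psi x), and the sum of d(N)/N over that dyadic
   range is O(psi x), so the series is dominated by the integral of the
   hypothesis.  Borel-Cantelli leaves finitely many pairs (k, n) with
   X_{k,n} > a_{k,n} + eps; these are absorbed because a_{m,j} is nondecreasing
   in mj and tends to infinity. *)

(** * Mean value of the divisor function *)

Section DivisorSum.
Variable R : realType.

(** The divisor function d(N), as a sum of indicators that matches term by term the union bound over
    the pairs (k, N / k). *)
Definition ndiv (N : nat) : nat := \sum_(k < N.+1) ((0 < k)%N && (k %| N)%N).

(** Each new term is at most an increment of the logarithm: ln (1 - 1/(m+2)) <= - 1/(m+2). *)
Lemma harmonic_sum_le (m : nat) : (0 < m)%N ->
  \sum_(1 <= k < m.+1) (k%:R : R)^-1 <= 1 + ln m%:R.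
Proof.
elim: m => // -[_ _|m IHm _]; first by rewrite big_nat1 invr1 ln1 addr0.
rewrite big_nat_recr//=; have {IHm} := IHm isT.
have m1 : 0 < (m.+1%:R : R) by rewrite ltr0n.
have m2 : 0 < (m.+2%:R : R) by rewrite ltr0n.
have h : -1 < - (m.+2%:R : R)^-1.
  by rewrite ltrN2 invf_lt1// ltr1n.
have := le_ln1Dx h; rewrite (_ : 1 + - _ = m.+1%:R / m.+2%:R); last first.
  by rewrite -[m.+2%:R]natr1; field; apply: lt0r_neq0; lra.
rewrite ln_div ?posrE//.
move: (ln m.+1%:R) (ln m.+2%:R) (m.+2%:R^-1 : R) (bigop.body _ _ _) => a b c s; lra.
Qed.

Lemma sum_dvdn (k m : nat) : (0 < k)%N ->
  (\sum_(1 <= N < m.+1) (k %| N)%N = m %/ k)%N.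
Proof.
move=> k0; elim: m => [|m IHm]; first by rewrite big_nil div0n.
by rewrite big_nat_recr//= IHm divnS// addnC.
Qed.

(** A range independent of N allows the order of summation to be exchanged. *)
Lemma ndivE (N m : nat) : (0 < N)%N -> (N <= m)%N ->
  ndiv N = (\sum_(1 <= k < m.+1) (k %| N)%N)%N.
Proof.
move=> N0 Nm; rewrite /ndiv -(big_mkord xpredT (fun k => (0 < k)%N && (k %| N)%N : nat)).
rewrite big_ltn//= add0n.
rewrite [RHS](big_cat_nat (n := N.+1))//= [X in (_ + X)%N]big_nat_cond.
rewrite [X in (_ + X)%N]big1 ?addn0; last first.
  by move=> i /andP[/andP[Ni _] _]; apply/eqP; rewrite eqb0; apply/negP => /(dvdn_leq N0); lia.
by apply: eq_big_nat => i /andP[i0 _]; rewrite i0.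
Qed.

(** Exchanging the sums counts multiples: each k contributes floor(m / k) <= m / k, and the harmonic
    bound finishes. *)
Lemma sum_ndiv_le (m : nat) : (0 < m)%N ->
  \sum_(1 <= N < m.+1) (ndiv N)%:R <= m%:R * (1 + ln m%:R) :> R.
Proof.
move=> m0; rewrite -natr_sum.
rewrite (eq_big_nat _ _ (F2 := fun N => (\sum_(1 <= k < m.+1) (k %| N))%N)); last first.
  by move=> N /andP[N1 Nm]; rewrite (@ndivE N m).
rewrite exchange_big/= natr_sum.
apply: (@le_trans _ _ (\sum_(1 <= k < m.+1) m%:R * (k%:R : R)^-1)).
  rewrite big_nat_cond [leRHS]big_nat_cond; apply: ler_sum => k /andP[/andP[k1 _] _].
  rewrite sum_dvdn// ler_pdivlMr ?ltr0n//.
  by rewrite -natrM ler_nat leq_trunc_div.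
by rewrite -mulr_sumr ler_wpM2l//; exact: harmonic_sum_le.
Qed.

(** On the range, 1/N <= 1/E, and the sum of d(N) over N <= 2E is at most 2E (1 + ln (2E)). The
    cut-off [M] is arbitrary, so all partial sums are bounded uniformly. *)
Lemma sum_ndiv_dyadic (E : R) (M : nat) : 1 <= E ->
  \sum_(1 <= N < M | (E <= N%:R) && (N%:R <= 2 * E)) (ndiv N)%:R / N%:R
    <= 2 * (1 + ln (2 * E)).
Proof.
move=> E1; pose m := Num.truncn (2 * E).
have E0 : 0 <= 2 * E by lra.
have m0 : (0 < m)%N by rewrite /m truncn_gt0; lra.
have mE : m%:R <= 2 * E by rewrite truncn_le.
apply: (@le_trans _ _ (E^-1 * \sum_(1 <= N < m.+1) (ndiv N)%:R)); last first.
  apply: (@le_trans _ _ (E^-1 * (2 * E * (1 + ln (2 * E))))); last first.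
    by rewrite !mulrA (_ : E^-1 * 2 * E = 2)//; field; apply: lt0r_neq0; lra.
  rewrite ler_wpM2l ?invr_ge0//; first lra.
  apply: le_trans (sum_ndiv_le m m0) _.
  have l0 : 0 <= ln (m%:R : R) by rewrite ln_ge0// ler1n.
  have : ln (m%:R : R) <= ln (2 * E) by rewrite ler_ln ?posrE ?ltr0n//; lra.
  by move=> ?; apply: ler_pM => //; lra.
rewrite mulr_sumr.
apply: (@le_trans _ _ (\sum_(1 <= N < M | (N < m.+1)%N) E^-1 * (ndiv N)%:R)).
  rewrite big_mkcond [leRHS]big_mkcond; apply: ler_sum => N _.
  case: ifPn => [/andP[EN NE]|_].
    rewrite ifT; last by rewrite ltnS /m truncn_ge_nat.
    by rewrite mulrC ler_wpM2r// lef_pV2 ?posrE//; lra.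
  by case: ifP => // _; rewrite mulr_ge0 ?invr_ge0//; lra.
have pos N : 0 <= E^-1 * (ndiv N)%:R :> R by rewrite mulr_ge0 ?invr_ge0//; lra.
have [Mm|mM] := leqP M m.+1; last by rewrite [leRHS](big_nat_widen _ _ _ _ _ (ltnW mM)).
(* [maxn 1 M] keeps the splitting point inside the range when [M] is 0. *)
rewrite [leLHS]big_mkcond [leRHS](big_cat_nat _ (n := maxn 1 M)); last 2 first.
- by rewrite leq_maxl.
- by rewrite geq_max Mm.
rewrite -[leLHS]addr0; apply: lerD; last exact: sumr_ge0.
have [M0|M1] := leqP M 0; last first.
  by rewrite (maxn_idPr M1); apply: ler_sum => N _; case: ifP.
by move: M0; rewrite leqn0 => /eqP->; rewrite !big_geq.
Qed.
End DivisorSum.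

(** * Measurability and integrals of monotone functions *)

Section MonotoneIntegral.
Variable R : realType.
Local Notation mu := (@lebesgue_measure R).

Lemma nondecreasing_integrable_itv (p : R -> R) (a b : R) (b0 b1 : bool) :
  {homo p : s t / s <= t} ->
  mu.-integrable [set` Interval (BSide b0 a) (BSide b1 b)] (EFin \o p).
Proof.
move=> hp; apply: measurable_bounded_integrable => //.
- by rewrite /= lebesgue_measure_itv/=; case: ifP => // _; rewrite -EFinB ltry.
- exact: nondecreasing_measurable.
exists (`|p a| + `|p b|); split; first exact: num_real.
move=> M hM x /= xI; apply: le_trans (ltW hM).
have {xI}: a <= x <= b by move: xI; rewrite in_itv/=; case: b0; case: b1 => /=; lra.
move=> /andP[/hp pa /hp pb].
have := ler_norm (p b); have := lerNnormlW (lexx `|p a|).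
by move=> h1 h2; rewrite ler_norml; move: (normr_ge0 (p a)) (normr_ge0 (p b)); lra.
Qed.

(** Precomposing with max(0, x) extends [f] to a function monotone on the whole line. *)
Lemma measurable_fun_nondecreasing_nonneg (f : R -> R) :
  (forall x y, 0 <= x -> x <= y -> f x <= f y) ->
  measurable_fun (`[0%R, +oo[%classic : set R) f.
Proof.
move=> hf; apply: (eq_measurable_fun (fun x : R => f (Num.max 0 x))).
  by move=> x; rewrite inE/= in_itv/= andbT => x0; rewrite max_r.
apply: nondecreasing_measurable => // x y xy; apply: hf.
  by rewrite le_max lexx.
by rewrite ge_max !le_max lexx/= xy orbT.
Qed.

Lemma ge0_integral_itv_split (f : R -> R) (a m b : R) :
  a <= m -> m <= b -> measurable_fun (`[a, b]%classic : set R) f ->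
  (forall x, a <= x -> x <= b -> 0 <= f x) ->
  (\int[mu]_(x in `[a, b]) (f x)%:E =
   \int[mu]_(x in `[a, m]) (f x)%:E + \int[mu]_(x in `[m, b]) (f x)%:E)%E.
Proof.
move=> am mb mf f0.
have mfE : measurable_fun (`[a, b]%classic : set R) (EFin \o f) by exact/measurable_EFinP.
have abE : `[a, b]%classic = `[a, m]%classic `|` `]m, b]%classic.
  by rewrite -itv_bndbnd_setU// bnd_simp.
have mE : measurable_fun `]m, b]%classic (EFin \o f).
  by apply: measurable_funS mfE => //; rewrite abE; exact: subsetUr.
rewrite -(@integral_itv_obnd_cbnd _ m)// abE.
apply: ge0_integral_setU => //=.
- by move: mfE; rewrite abE.
- by move=> x; rewrite !in_itv/= lee_fin => -[] /andP[? ?]; apply: f0; lra.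
- by apply/disj_setPS => x /= []; rewrite !in_itv/=; lra.
Qed.

End MonotoneIntegral.

(** * The Young conjugate, its subgradient [q] and its inverse *)

Section Conjugate.
Variables (R : realType) (phi p : R -> R).
Hypotheses (Nphi : N_function phi) (dphi : is_density phi p).
Local Notation mu := (@lebesgue_measure R).
Local Notation q := (gen_inv p).
Local Notation psi := (young phi).

Let phiN x : phi (- x) = phi x. Proof. by case: Nphi => _ []. Qed.
Let phi0 : phi 0 = 0. Proof. by case: Nphi => _ [_ [_ []]]. Qed.
Let phi_incr x y : 0 < x -> x < y -> phi x < phi y.
Proof. by case: Nphi => _ [_ [_ [_ [h _]]]]; exact: h. Qed.
Let p_homo : {homo p : s t / s <= t}. Proof. by case: dphi. Qed.

(** 0 is the midpoint of x and -x, where [phi] takes the same value; convexity concludes. *)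
Lemma N_function_ge0 x : 0 <= phi x.
Proof.
case: Nphi => _ [_ [cvx _]]; have /(_ _ _) := cvx x (- x) (1 / 2).
rewrite phiN (_ : _ + _ = 0); last by field.
rewrite phi0 => /(_ ltac:(lra) ltac:(lra)); lra.
Qed.

Lemma N_function_le x y : 0 <= x -> x <= y -> phi x <= phi y.
Proof.
rewrite le_eqVlt => /predU1P[<- _|x0]; first by rewrite phi0 N_function_ge0.
by rewrite le_eqVlt => /predU1P[->//|/(phi_incr _ _ x0)/ltW].
Qed.

(** The open interval lets the increment bounds below ignore the values of [p] at the endpoints,
    where it may jump. *)
Lemma density_Rintegral a b : 0 <= a -> a <= b ->
  phi b - phi a = (\int[mu]_(t in `]a, b[) p t)%R.
Proof.
move=> a0 ab; case: dphi => _ h.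
have E x : 0 <= x -> phi x = (\int[mu]_(t in `[0%R, x]) p t)%R.
  by move=> x0; rewrite /Rintegral; have := h x; rewrite (ger0_norm x0) => <-.
rewrite (E b) ?(E a)//; last lra.
rewrite Rintegral_itvB ?bnd_simp//; last exact: nondecreasing_integrable_itv.
by rewrite -Rintegral_itv_bndo_bndc//; exact: nondecreasing_integrable_itv.
Qed.

Let Rintegral_cst_oo c (a b : R) : a <= b ->
  (\int[mu]_(t in `]a, b[) c)%R = c * (b - a).
Proof.
move=> ab; rewrite Rintegral_cst//= lebesgue_measure_itv/= lte_fin.
have [//|ba] := ltP a b.
by rewrite (_ : b - a = 0)//=; lra.
Qed.

Lemma increment_le c a b : 0 <= a -> a <= b ->
  (forall x, a < x -> x < b -> p x <= c) -> phi b - phi a <= c * (b - a).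
Proof.
move=> a0 ab hc; rewrite density_Rintegral// -Rintegral_cst_oo//.
apply: le_Rintegral => //; try exact: nondecreasing_integrable_itv.
by move=> x /=; rewrite in_itv/= => /andP[? ?]; exact: hc.
Qed.

Lemma increment_ge c a b : 0 <= a -> a <= b ->
  (forall x, a < x -> x < b -> c <= p x) -> c * (b - a) <= phi b - phi a.
Proof.
move=> a0 ab hc; rewrite density_Rintegral// -Rintegral_cst_oo//.
apply: le_Rintegral => //; try exact: nondecreasing_integrable_itv.
by move=> x /=; rewrite in_itv/= => /andP[? ?]; exact: hc.
Qed.

(** By monotonicity p(0) x <= phi(x), and phi(x)/x tends to 0. Hence 0 belongs to the set defining
    q(t) for every t >= 0. *)
Lemma density0_le0 : p 0 <= 0.
Proof.
case: Nphi => _ [_ [_ [_ [_ [lim0 _]]]]].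
apply/ler_addgt0Pl => e e0; rewrite addr0.
have near0 : \forall x \near (0 : R)^'+, `|0 - phi x / x| < e by move/cvgrPdist_lt : lim0; exact.
have [x [x0]] : exists x, 0 < x /\ `|0 - phi x / x| < e.
  near (0 : R)^'+ => x; exists x; split; first by near: x; exact: nbhs_right_gt.
  by near: x.
rewrite sub0r normrN => /(le_lt_trans (ler_norm _)); rewrite ltr_pdivrMr// => h.
have : p 0 * (x - 0) <= phi x - phi 0.
  by apply: increment_ge => //; [exact: ltW|move=> y y0 _; apply: p_homo; lra].
by rewrite phi0 !subr0 => /le_lt_trans/(_ h); rewrite ltr_pM2r// => /ltW.
Unshelve. all: by end_near. Qed.

(** Take B with phi(B) >= (t + 1) B. If p(u) <= t for some u > B, then phi(B) <= t B, a
    contradiction. This makes the supremum q(t) finite. *)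
Lemma density_coercive t : exists2 B, 0 <= B & forall u, p u <= t -> u <= B.
Proof.
case: Nphi => _ [_ [_ [_ [_ [_ /cvgryPge/(_ (t + 1)) limy]]]]].
have [B [B0]] : exists x, 0 < x /\ t + 1 <= phi x / x.
  near (+oo : set_system R) => x; exists x; split; last by near: x.
  by near: x; exact: nbhs_pinfty_gt.
rewrite ler_pdivlMr// => h; exists B; first exact: ltW.
move=> u pu; rewrite leNgt; apply/negP => Bu.
have : phi B - phi 0 <= t * (B - 0).
  apply: increment_le => //; first exact: ltW.
  by move=> x _ xB; apply: le_trans pu; apply: p_homo; lra.
rewrite phi0 !subr0; have : t * B < (t + 1) * B by rewrite ltr_pM2r//; lra.
lra.
Unshelve. all: by end_near. Qed.

Lemma gen_inv_has_sup t : 0 <= t -> has_sup [set u | 0 <= u /\ p u <= t].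
Proof.
move=> t0; split; first by exists 0; split => //; exact: le_trans density0_le0 t0.
by have [B _ hB] := density_coercive t; exists B => u [_ /hB].
Qed.

Lemma le_gen_inv t u : 0 <= t -> 0 <= u -> p u <= t -> u <= q t.
Proof. by move=> t0 u0 pu; apply: ub_le_sup => //; exact: (gen_inv_has_sup t t0).2. Qed.

Lemma gen_inv_ge0 t : 0 <= t -> 0 <= q t.
Proof. by move=> t0; apply: le_gen_inv => //; exact: le_trans density0_le0 t0. Qed.

(** Partial converse of [le_gen_inv]; the inequality is strict because p may jump above t at
    q(t). *)
Lemma lt_gen_inv t u : 0 <= t -> u < q t -> p u <= t.
Proof.
move=> t0 uq; have [|v [_ pv]] := sup_adherent (_ : 0 < q t - u) (gen_inv_has_sup t t0).
  by rewrite subr_gt0.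
by rewrite opprB addrC subrK => /ltW/p_homo/le_trans; exact.
Qed.

Lemma gen_inv_le s t : 0 <= s -> s <= t -> q s <= q t.
Proof.
move=> s0 st; apply: ge_sup; first exact: (gen_inv_has_sup s s0).1.
by move=> u [u0 pu]; apply: le_gen_inv => //; [lra|exact: le_trans st].
Qed.

(** The slope t - p(y) of t y - phi(y) is nonnegative before q(t) and negative after it; evenness of
    [phi] reduces y < 0 to -y. *)
Lemma gen_inv_maximizes t y : 0 <= t -> t * y - phi y <= t * q t - phi (q t).
Proof.
move=> t0; wlog y0 : y / 0 <= y => [hw|].
  have [/hw//|y0] := leP 0 y; have := hw (- y); rewrite phiN => /(_ _).
  by move=> h; apply: le_trans (h _); [rewrite lerD2r ler_wpM2l//; lra|lra].
have q0 := gen_inv_ge0 t t0.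
have [yq|qy] := leP y (q t).
  have := @increment_le t y (q t) y0 yq; move=> /(_ (fun x _ xq => lt_gen_inv t x t0 xq)).
  rewrite mulrBr; lra.
have : t * (y - q t) <= phi y - phi (q t).
  apply: increment_ge => //; first exact: ltW.
  move=> x qx _; rewrite leNgt; apply/negP => /ltW pt.
  have : x <= q t by apply: le_gen_inv => //; lra.
  lra.
rewrite mulrBr; lra.
Qed.

Lemma young_gen_inv t : 0 <= t -> psi t = t * q t - phi (q t).
Proof.
move=> t0; apply/eqP; rewrite eq_le; apply/andP; split.
  apply: ge_sup; first by exists (t * 0 - phi 0); exists 0.
  by move=> _ [y _ <-]; exact: gen_inv_maximizes.
apply: ub_le_sup; last by exists (q t).
by exists (t * q t - phi (q t)) => _ [y _ <-]; exact: gen_inv_maximizes.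
Qed.

Lemma fenchel_young t y : 0 <= t -> t * y - phi y <= psi t.
Proof. by move=> t0; rewrite young_gen_inv//; exact: gen_inv_maximizes. Qed.

(** Young's inequality at (b, q(a)), combined with its equality case at (a, q(a)). *)
Lemma young_subgradient a b : 0 <= a -> 0 <= b ->
  psi a + q a * (b - a) <= psi b.
Proof.
move=> a0 b0; have := fenchel_young b (q a) b0; rewrite (young_gen_inv a)//; lra.
Qed.

Lemma young_ge0 t : 0 <= t -> 0 <= psi t.
Proof. by move=> t0; have := fenchel_young t 0 t0; rewrite phi0 mulr0 subr0. Qed.

Lemma young0 : psi 0 = 0.
Proof.
apply/eqP; rewrite eq_le young_ge0// andbT young_gen_inv// mul0r sub0r.
by rewrite oppr_le0 N_function_ge0.
Qed.

Lemma young_le a b : 0 <= a -> a <= b -> psi a <= psi b.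
Proof.
move=> a0 ab; have := young_subgradient a b a0 (le_trans a0 ab).
have : 0 <= q a * (b - a) by rewrite mulr_ge0 ?gen_inv_ge0// subr_ge0.
lra.
Qed.

(** Testing the conjugate at y = 1 gives psi(u) >= u - phi(1), which bounds u. *)
Lemma inv_pos_has_sup v : 0 <= v -> has_sup [set u | 0 <= u /\ psi u <= v].
Proof.
move=> v0; split; first by exists 0; rewrite /= young0.
exists (v + phi 1) => u [u0]; have := fenchel_young u 1 u0; lra.
Qed.

Lemma le_inv_pos v u : 0 <= v -> 0 <= u -> psi u <= v -> u <= inv_pos psi v.
Proof. by move=> v0 u0 pu; apply: ub_le_sup => //; exact: (inv_pos_has_sup v v0).2. Qed.

Lemma inv_pos_ge0 v : 0 <= v -> 0 <= inv_pos psi v.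
Proof. by move=> v0; apply: le_inv_pos => //; rewrite young0. Qed.

Lemma inv_pos_le v w : 0 <= v -> v <= w -> inv_pos psi v <= inv_pos psi w.
Proof.
move=> v0 vw; apply: ge_sup; first exact: (inv_pos_has_sup v v0).1.
by move=> u [u0 pu]; apply: le_inv_pos => //; lra.
Qed.

(** Subgradients play the role of continuity: points of the set just below u bound psi(u) above by
    v, and psi(u) < v would leave room for a point w > u in the set. *)
Lemma inv_posK v : 0 <= v -> psi (inv_pos psi v) = v.
Proof.
move=> v0; set u := inv_pos psi v; have u0 : 0 <= u by exact: inv_pos_ge0.
have qu0 := gen_inv_ge0 _ u0.
apply/eqP; rewrite eq_le; apply/andP; split.
  apply/ler_addgt0Pr => e e0.
  (* The added 1 covers the case q(u) = 0. *)
  have d0 : 0 < e / (q u + 1) by rewrite divr_gt0//; lra.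
  have [w [w0 pw] uw] := sup_adherent d0 (inv_pos_has_sup v v0).
  have := young_subgradient u w u0 w0.
  suff : q u * (u - w) <= e by lra.
  apply: (@le_trans _ _ (q u * (e / (q u + 1)))).
    by rewrite ler_wpM2l//; rewrite -/(inv_pos psi v) -/u in uw; lra.
  by rewrite mulrA ler_pdivrMr; nra.
apply/ler_addgt0Pr => e e0; rewrite leNgt; apply/negP => h.
have q1 : 0 <= q (u + 1) by rewrite gen_inv_ge0//; lra.
(* Capping the step at 1 bounds the slope q(w) by q(u + 1), which does not depend on w. *)
pose w := u + Num.min 1 (e / (q (u + 1) + 1)).
have d0 : 0 < e / (q (u + 1) + 1) by rewrite divr_gt0//; lra.
have uw : u < w by rewrite /w ltrDl lt_min d0 ltr01.
have w1 : w <= u + 1 by rewrite /w lerD2l ge_min lexx.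
have w2 : w - u <= e / (q (u + 1) + 1) by rewrite /w addrC addKr ge_min lexx orbT.
suff : w <= u by lra.
apply: le_inv_pos => //; first lra.
have := young_subgradient w u _ u0 => /(_ ltac:(lra)).
suff : q w * (w - u) <= e by lra.
apply: (@le_trans _ _ (q (u + 1) * (e / (q (u + 1) + 1)))).
  apply: ler_pM => //; [apply: gen_inv_ge0; lra|lra|apply: gen_inv_le; lra].
by rewrite mulrA ler_pdivrMr; nra.
Qed.

Let measurable_gen_inv_itv a b : 0 <= a ->
  measurable_fun (`[a, b]%classic : set R) q.
Proof.
move=> a0; apply: measurable_funS;
  last exact: measurable_fun_nondecreasing_nonneg gen_inv_le; first by [].
by move=> x /=; rewrite !in_itv/= andbT => /andP[+ _]; exact: le_trans.
Qed.

(* The error [(q b - q a) * (b - a)] of the left Riemann sum telescopes under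
   bisection, which halves it at each step. *)
Let increment_young_bisect n a b : 0 <= a -> a <= b ->
  ((psi b - psi a)%:E <= \int[mu]_(x in `[a, b]) (q x)%:E
     + ((q b - q a) * (b - a) / 2 ^+ n)%:E)%E.
Proof.
elim: n a b => [|n IHn] a b a0 ab; have mq := measurable_gen_inv_itv a b a0.
  (* The subgradient at b gives psi(b) - psi(a) <= q(b) (b - a): the left rectangle plus the
     error. *)
  rewrite expr0 divr1; apply: (@le_trans _ _ ((q a * (b - a))%:E +
    ((q b - q a) * (b - a))%:E)%E).
    rewrite -EFinD lee_fin.
    have := young_subgradient b a (le_trans a0 ab) a0; lra.
  rewrite leeD2r//.
  have -> : (q a * (b - a))%:E = (\int[mu]_(x in `[a, b]) (q a)%:E)%E.
    rewrite integral_cst//= lebesgue_measure_itv/= lte_fin.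
    have [//|ba] := ltP a b; rewrite -?EFinB ?EFinM//.
    by rewrite (_ : b - a = 0) ?mulr0 ?mule0//; lra.
  apply: ge0_le_integral => //=.
  - by move=> x _; rewrite lee_fin gen_inv_ge0.
  - exact/measurable_EFinP.
  - by move=> x; rewrite in_itv/= => /andP[ax _]; rewrite lee_fin gen_inv_le.
pose m := (a + b) / 2; have am : a <= m by rewrite /m; lra.
have mb : m <= b by rewrite /m; lra.
rewrite (@ge0_integral_itv_split _ q a m b am mb mq); last first.
  by move=> x ax _; apply: gen_inv_ge0; exact: le_trans ax.
have -> : psi b - psi a = (psi m - psi a) + (psi b - psi m) by ring.
have -> : (q b - q a) * (b - a) / 2 ^+ n.+1 =
   (q m - q a) * (m - a) / 2 ^+ n + (q b - q m) * (b - m) / 2 ^+ n.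
  rewrite exprS /m; have : (2 : R) ^+ n != 0 by rewrite expf_neq0.
  by move=> ?; field.
rewrite EFinD; apply: le_trans (leeD (IHn a m a0 am) (IHn m b (le_trans a0 am) mb)) _.
by rewrite addeACA -EFinD.
Qed.

(** The bisection error vanishes in the limit. This converts a growth of [psi] by ln 2 on a block
    into a lower bound for the integral of [q] there. *)
Lemma increment_young_le_integral a b : 0 <= a -> a <= b ->
  ((psi b - psi a)%:E <= \int[mu]_(x in `[a, b]) (q x)%:E)%E.
Proof.
move=> a0 ab; apply/lee_addgt0Pr => e e0.
set c := (q b - q a) * (b - a).
have c0 : 0 <= c by rewrite mulr_ge0 ?subr_ge0//; exact: gen_inv_le.
have [n hn] : exists n : nat, c / 2 ^+ n <= e.
  (* This n exceeds c / e, and n < 2^n. *)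
  exists (Num.truncn (c / e)).+1; rewrite ler_pdivrMr ?exprn_gt0//.
  rewrite mulrC -ler_pdivrMr//; apply: ltW.
  apply: lt_le_trans (truncnS_gt _) _.
  by rewrite -natrX ler_nat ltnW// ltn_expl.
by apply: le_trans (increment_young_bisect n a b a0 ab) _; rewrite leeD2l// lee_fin.
Qed.

(** * Comparison of the tail series with the integral of the hypothesis *)

Section TailSeries.
Variable g : R -> R.
Hypotheses (g_gt0 : forall x, 0 <= x -> 0 < g x)
  (g_le : forall x y, 0 <= x -> x <= y -> g x <= g y).

Let damp e x := expR (- (e * q x) / g (psi x + ln 2)).

Let ln2_gt0 : 0 < ln (2 : R). Proof. by rewrite ln_gt0// ltr1n. Qed.

Local Notation itv_nng := (`[0%R, +oo[%classic : set R).

Let measurable_q : measurable_fun itv_nng q.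
Proof. exact: measurable_fun_nondecreasing_nonneg gen_inv_le. Qed.

Let measurable_psi : measurable_fun itv_nng psi.
Proof. exact: measurable_fun_nondecreasing_nonneg young_le. Qed.

Let measurable_damped e : measurable_fun itv_nng (fun x => q x * damp e x).
Proof.
apply: measurable_funM => //; apply: measurableT_comp => //.
rewrite (_ : (fun _ => _) = (fun x => e * q x * - (g (psi x + ln 2))^-1)); last first.
  by apply/funext => x; rewrite mulNr mulrN.
apply: measurable_funM; first exact: measurable_funM.
apply: measurable_fun_nondecreasing_nonneg => x y x0 xy.
have psix := young_ge0 x x0; have psixy := young_le x y x0 xy.
have l2 := ln2_gt0.
have gx : 0 < g (psi x + ln 2) by apply: g_gt0; lra.
have gy : 0 < g (psi y + ln 2) by apply: g_gt0; lra.
by rewrite lerN2 lef_pV2 ?posrE//; apply: g_le; lra.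
Qed.

Local Notation block N :=
  (`[inv_pos psi (ln N%:R - ln 2), inv_pos psi (ln N%:R)]%classic : set R).

(** The reason to start the series at N = 4: [psi] is at least ln 2 on every block, so additive
    constants can be absorbed into a multiple of [psi]. *)
Let ln4_le (N : nat) : (4 <= N)%N -> ln 2 <= ln N%:R - ln 2 :> R.
Proof.
move=> N4; rewrite lerBrDr -lnM ?posrE//.
by rewrite ler_ln ?posrE ?ltr0n//; [rewrite -natrM ler_nat|lia].
Qed.

Let block_nng N : (4 <= N)%N -> block N `<=` itv_nng.
Proof.
have l2 := ln2_gt0; move=> /ln4_le N4 x /=; rewrite !in_itv/= andbT => /andP[+ _].
by apply: le_trans; apply: inv_pos_ge0; lra.
Qed.

Let block_young N x : (4 <= N)%N -> block N x ->
  ln N%:R - ln 2 <= psi x <= ln N%:R.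
Proof.
move=> N4 Nx; have := block_nng _ N4 _ Nx; rewrite /= in_itv/= andbT => x0.
have {}N4 := ln4_le N N4; have l2 := ln2_gt0.
move: Nx; rewrite /= in_itv/= => /andP[ax xb]; apply/andP; split.
  rewrite -[leLHS]inv_posK; last lra.
  by apply: young_le => //; apply: inv_pos_ge0; lra.
by rewrite -[leRHS]inv_posK; [exact: young_le|lra].
Qed.

Let term e (N : nat) :=
  expR (- (e * q (inv_pos psi (ln N%:R))) / g (ln N%:R)).

(** On the block x <= u_N, so q(x) <= q(u_N); and ln N <= psi(x) + ln 2, so the shift by ln 2 gives
    g(ln N) <= g(psi(x) + ln 2). *)
Let term_le_damp e N x : 0 <= e -> (4 <= N)%N -> block N x -> term e N <= damp e x.
Proof.
move=> e0 N4 Nx; have /andP[psi1 psi2] := block_young _ _ N4 Nx.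
have := block_nng _ N4 _ Nx; rewrite /= in_itv/= andbT => x0.
have lN := ln4_le N N4; have l2 := ln2_gt0.
have gx : 0 < g (psi x + ln 2) by apply: g_gt0; lra.
have gN : 0 < g (ln N%:R) by apply: g_gt0; lra.
rewrite ler_expR !mulNr lerN2.
have qx : q x <= q (inv_pos psi (ln N%:R)).
  by apply: gen_inv_le => //; move: Nx; rewrite /= in_itv/= => /andP[].
apply: ler_pM.
- by rewrite mulr_ge0// gen_inv_ge0.
- by rewrite invr_ge0 ltW.
- by rewrite ler_wpM2l.
- by rewrite lef_pV2 ?posrE//; apply: g_le; lra.
Qed.

Let weight (N : nat) : R := (ndiv N)%:R / N%:R.

Let weight_ge0 N : 0 <= weight N. Proof. by rewrite divr_ge0. Qed.

Let measurable_blocked e N : measurable_fun itv_nng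
  (fun x => (weight N * \1_(block N) x * (q x * damp e x))%:E).
Proof.
apply/measurable_EFinP; apply: measurable_funM; last exact: measurable_damped.
by apply: measurable_funM => //; exact: measurable_indic.
Qed.

(** The integral of [q] over the block is at least the growth ln 2 of [psi], and [damp] is at least
    [term] there. The indicator puts all blocks on a common domain. *)
Let block_integral e N : 0 <= e -> (4 <= N)%N ->
  ((ln 2 * (weight N * term e N))%:E <=
   \int[mu]_(x in itv_nng) (weight N * \1_(block N) x * (q x * damp e x))%:E)%E.
Proof.
move=> e0 N4; have lN := ln4_le N N4; have l2 := ln2_gt0.
have wt0 : 0 <= weight N * term e N by rewrite mulr_ge0// expR_ge0.
have mf := measurable_blocked e N.
have f0 x : itv_nng x -> (0%R <= (weight N * \1_(block N) x * (q x * damp e x))%:E)%E.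
  rewrite /= in_itv/= andbT => x0; rewrite lee_fin !mulr_ge0// ?expR_ge0//.
  exact: gen_inv_ge0.
apply: (@le_trans _ _ (\int[mu]_(x in block N)
    (weight N * \1_(block N) x * (q x * damp e x))%:E)%E); last first.
  by apply: ge0_subset_integral => //; exact: block_nng.
apply: (@le_trans _ _ (\int[mu]_(x in block N) ((weight N * term e N)%:E * (q x)%:E))%E).
  rewrite ge0_integralZl_EFin//; last 2 first.
  - move=> x /(block_nng _ N4); rewrite /= in_itv/= andbT lee_fin; exact: gen_inv_ge0.
  - apply/measurable_EFinP; apply: measurable_funS measurable_q => //.
    exact: block_nng.
  rewrite mulrC EFinM lee_wpmul2l ?lee_fin//.
  have a0 : 0 <= ln N%:R - ln 2 :> R by lra.
  have := increment_young_le_integral _ _ (inv_pos_ge0 _ a0)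
    (inv_pos_le _ (ln N%:R) a0 ltac:(lra)).
  by rewrite !inv_posK ?subKr//; lra.
apply: ge0_le_integral => //.
- move=> x /(block_nng _ N4); rewrite /= in_itv/= andbT => x0.
  by rewrite -EFinM lee_fin mulr_ge0// gen_inv_ge0.
- apply: measurable_funeM; apply/measurable_EFinP.
  by apply: measurable_funS measurable_q => //; exact: block_nng.
- by apply: measurable_funS mf => //; exact: block_nng.
move=> x Nx; rewrite -EFinM lee_fin indicE mem_set// mulr1 -mulrA ler_wpM2l//.
rewrite mulrC ler_wpM2l ?term_le_damp//.
by apply: gen_inv_ge0; have := block_nng _ N4 _ Nx; rewrite /= in_itv/= andbT.
Qed.

(** Only N between exp(psi(x)) and 2 exp(psi(x)) count, so the dyadic estimate applies with E =
    exp(psi(x)). *)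
Let sum_block_le M x : 0 <= x ->
  \sum_(4 <= N < M) weight N * \1_(block N) x <= 2 * ((ln 2)^-1 + 2) * psi x.
Proof.
move=> x0; have psi0 := young_ge0 x x0; have l2 := ln2_gt0.
have iln2 : 0 < (ln 2 : R)^-1 by rewrite invr_gt0.
have [small|large] := ltP (psi x) (ln 2).
  rewrite big_nat_cond big1 ?mulr_ge0//; first lra.
  move=> N /andP[/andP[N4 _] _]; rewrite indicE memNset ?mulr0// => Nx.
  have /andP[] := block_young _ _ N4 Nx; have := ln4_le N N4; lra.
have E1 : 1 <= expR (psi x) by rewrite -[leLHS]expR0 ler_expR.
have [M4|M4] := leqP M 4; first by rewrite big_geq// !mulr_ge0//; lra.
(* As psi(x) >= ln 2, the constant 1 is at most psi(x) / ln 2 and ln 2 is at most psi(x). *)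
apply: (@le_trans _ _ (2 * (1 + ln (2 * expR (psi x))))); last first.
  rewrite lnM ?posrE ?expR_gt0// expRK -mulrA ler_wpM2l// mulrDl.
  have : 1 <= (ln 2)^-1 * psi x by rewrite -ler_pdivrMl// invrK mulr1.
  lra.
apply: le_trans (sum_ndiv_dyadic _ _ M E1).
rewrite [leRHS](@big_cat_nat _ _ _ 4)//=; last lia.
rewrite -[leLHS]add0r; apply: lerD; first by apply: sumr_ge0.
rewrite [leRHS]big_mkcond/= big_nat_cond [leRHS]big_nat_cond; apply: ler_sum => N.
move=> /andP[/andP[N4 _] _].
rewrite indicE; case: (boolP (x \in block N)) => [|_]; last first.
  by rewrite mulr0; case: ifP.
rewrite inE => Nx; have /andP[psi1 psi2] := block_young _ _ N4 Nx.
have N0 : 0 < N%:R :> R by rewrite ltr0n; lia.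
rewrite mulr1 ifT//; apply/andP; split.
  by rewrite -[leRHS]lnK ?posrE// ler_expR.
rewrite -ler_ln ?posrE ?mulr_gt0 ?expR_gt0// lnM ?posrE ?expR_gt0// expRK; lra.
Qed.

Lemma tail_series_bounded e : 0 <= e ->
  (\int[mu]_(x in `[0%R, +oo[) (psi x * q x * expR (- (e * q x) / g (psi x + ln 2)))%:E
     < +oo)%E ->
  exists K, forall M, \sum_(4 <= N < M) (ndiv N)%:R / N%:R *
     expR (- (e * q (inv_pos psi (ln N%:R))) / g (ln N%:R)) <= K.
Proof.
move=> e0 fin; set J := (\int[mu]_(x in _) _)%E in fin.
have J0 : (0 <= J)%E.
  apply: integral_ge0 => x /=; rewrite in_itv/= andbT => x0.
  by rewrite lee_fin !mulr_ge0 ?expR_ge0 ?young_ge0 ?gen_inv_ge0.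
have iln2 : 0 < (ln 2 : R)^-1 by rewrite invr_gt0.
pose C : R := 2 * ((ln 2)^-1 + 2); have C0 : 0 <= C by rewrite /C; lra.
(* The factor 1 / ln 2 undoes the ln 2 of [block_integral]; [C] is the overlap constant of
   [sum_block_le]. *)
exists ((ln 2)^-1 * (C * fine J)) => M.
rewrite ler_pdivlMl// mulr_sumr -lee_fin EFinM fineK ?ge0_fin_numE//.
rewrite -sumEFin.
apply: (@le_trans _ _ (\sum_(4 <= N < M)
   \int[mu]_(x in itv_nng) (weight N * \1_(block N) x * (q x * damp e x))%:E)%E).
  rewrite big_nat_cond [leRHS]big_nat_cond; apply: lee_sum => N /andP[/andP[N4 _] _].
  exact: block_integral.
rewrite -ge0_integral_sum//; last 2 first.
- exact: measurable_blocked.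
- move=> N x; rewrite /= in_itv/= andbT => x0; rewrite lee_fin !mulr_ge0// ?expR_ge0//.
  exact: gen_inv_ge0.
have mJ : measurable_fun itv_nng (fun x => psi x * q x * damp e x).
  rewrite (_ : (fun _ => _) = (fun x => psi x * (q x * damp e x))).
    by apply: measurable_funM; [exact: measurable_psi|exact: measurable_damped].
  by apply/funext => x; rewrite mulrA.
rewrite /J -ge0_integralZl_EFin//; last 2 first.
- move=> x; rewrite /= in_itv/= andbT => x0.
  by rewrite lee_fin !mulr_ge0 ?expR_ge0 ?young_ge0 ?gen_inv_ge0.
- exact/measurable_EFinP.
apply: ge0_le_integral => //.
- move=> x; rewrite /= in_itv/= andbT => x0; rewrite sumEFin lee_fin; apply: sumr_ge0 => N _.
  by rewrite !mulr_ge0// ?expR_ge0// gen_inv_ge0.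
- by apply: emeasurable_sum => N; exact: measurable_blocked.
- by apply: measurable_funeM; exact/measurable_EFinP.
move=> x; rewrite /= in_itv/= andbT => x0; rewrite sumEFin -EFinM lee_fin -mulr_suml.
rewrite -[_ * _ * expR _]mulrA [leRHS]mulrA ler_wpM2r//; last exact: sum_block_le.
by rewrite mulr_ge0 ?expR_ge0// gen_inv_ge0.
Qed.

End TailSeries.

End Conjugate.

(** * Exponential tails of subgaussian variables *)

Section TailBound.
Variables (R : realType) (phi p : R -> R).
Hypotheses (Nphi : N_function phi) (dphi : is_density phi p).
Variables (d : measure_display) (T : measurableType d) (P : probability T R).
Local Notation q := (gen_inv p).
Local Notation psi := (young phi).

(** For each c > 1 the infimum [tau] yields an admissible a < c G, hence the bound exp(phi(c s));
    continuity of [phi] lets c decrease to 1. *)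
Lemma mgf_le_of_tau_le (X : {mfun T >-> R}) (G s : R) :
  subgaussian P phi X -> tau P phi X <= G -> 0 < G -> 0 <= s ->
  ('M_P X (s / G) <= (expR (phi s))%:E)%E.
Proof.
move=> [_ [a0 [a0_gt0 mgf0]]] tauG G0 s0.
have bnd c : 1 < c -> ('M_P X (s / G) <= (expR (phi (c * s)))%:E)%E.
  move=> c1.
  have [a [a_gt0 mgfa] ac] : exists2 a, 0 < a /\ mgf_bound P phi X a & a < G * c.
    apply: inf_lt; first by exists a0.
    by apply: le_lt_trans tauG _; rewrite ltr_pMr.
  rewrite /mmt_gen_fun unlock; apply: (@le_trans _ _ (expR (phi (a * (s / G))))%:E).
    by under eq_integral do rewrite /= mulrC; exact: mgfa.
  rewrite lee_fin ler_expR; apply: (N_function_le _ _ Nphi).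
    by rewrite mulr_ge0 ?divr_ge0// ltW.
  by rewrite mulrA ler_pdivrMr//; have := ler_wpM2r s0 (ltW ac); lra.
have M0 : (0%R <= 'M_P X (s / G))%E.
  by rewrite /mmt_gen_fun unlock; apply: integral_ge0 => w _; rewrite lee_fin expR_ge0.
have fM : 'M_P X (s / G) \is a fin_num.
  rewrite ge0_fin_numE//; apply: le_lt_trans (bnd 2 _) _; first by rewrite ltr1n.
  by rewrite ltry.
rewrite -(fineK fM) lee_fin.
have lim1 : expR (phi (c * s)) @[c --> (1 : R)^'+] --> expR (phi s).
  apply: cvg_at_right_filter; rewrite -[in X in _ --> X](mul1r s).
  apply: (continuous_comp (f := fun c : R => c * s) (g := expR \o phi)).
    exact: mulrr_continuous.
  apply: continuous_comp; last exact: continuous_expR.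
  by case: Nphi => + _; exact.
rewrite -(cvg_lim _ lim1)//; apply: limr_ge; first by apply/cvg_ex; eexists; exact: lim1.
near=> c; rewrite -lee_fin fineK//; apply: bnd.
by near: c; exact: nbhs_right_gt.
Unshelve. all: by end_near. Qed.

(* Chernoff's bound at the slope [q u / G], where Young's inequality is an equality. *)
Lemma subgaussian_tail (X : {mfun T >-> R}) (G v e : R) :
  subgaussian P phi X -> tau P phi X <= G -> 0 < G -> 0 < v ->
  (P [set w | (G * inv_pos psi v + e <= X w)%R] <=
   (expR (- v) * expR (- (e * q (inv_pos psi v)) / G))%:E)%E.
Proof.
move=> sX tauG G0 v0; set u := inv_pos psi v.
have u0 : 0 <= u by exact: (inv_pos_ge0 _ _ _ Nphi dphi v (ltW v0)).
have psiu : psi u = v by exact: (inv_posK _ _ _ Nphi dphi v (ltW v0)).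
have young_eq := young_gen_inv _ _ _ Nphi dphi u u0; rewrite psiu in young_eq.
(* Chernoff's bound takes a positive slope; q(u) = 0 would turn the equality case into v = 0. *)
have q0 : 0 < q u.
  rewrite lt_neqAle (gen_inv_ge0 _ _ _ Nphi dphi)// andbT eq_sym; apply/eqP => qu0.
  move: young_eq; rewrite qu0 mulr0 (_ : phi 0 = 0); first lra.
  by case: Nphi => _ [_ [_ []]].
apply: le_trans (chernoff X (G * u + e) (divr_gt0 q0 G0)) _.
apply: (@le_trans _ _ ((expR (phi (q u)))%:E * (expR (- (q u / G * (G * u + e))))%:E)%E).
  by rewrite lee_wpmul2r ?lee_fin ?expR_ge0// mgf_le_of_tau_le// ltW.
rewrite -EFinM -!expRD lee_fin ler_expR young_eq.
rewrite (_ : - (q u / G * _) = - (u * q u) + - (e * q u) / G); first lra.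
by field; apply: lt0r_neq0.
Qed.

End TailBound.

(** * The first Borel-Cantelli lemma, from bounded partial sums *)

Section BorelCantelli.
Variables (R : realType) (d : measure_display) (T : measurableType d).
Variables (P : probability T R).

Lemma Borel_Cantelli_eventually (B : nat -> set T) (N0 : nat) (K : R) :
  (forall N, measurable (B N)) ->
  (forall M, (\sum_(N0 <= N < M) P (B N) <= K%:E)%E) ->
  {ae P, forall w, exists N1, forall N, (N1 <= N)%N -> ~ B N w}.
Proof.
(* The shift discards the events before [N0], which the bound on the sums does not cover. *)
move=> mB sumB; pose F n := B (n + N0)%N.
have mF k : measurable (F k) by exact: mB.
exists (lim_sup_set F); split.
- by apply: bigcap_measurableType => n _; exact: bigcup_measurable.
- apply: lim_sup_set_cvg0 => //; apply: (@le_lt_trans _ _ K%:E); last exact: ltry.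
  apply: lime_le; first by apply: is_cvg_nneseries => *; exact: measure_ge0.
  near=> M; apply: le_trans (sumB (M + N0)%N).
  by rewrite -{1}[N0]add0n big_addn addnK.
move=> w /= nw n _; apply: contrapT => h; apply: nw; exists (n + N0)%N => N nN BN.
apply: h; exists (N - N0)%N => /=; first
  by rewrite leq_subRL ?(leq_trans _ nN)// ?leq_addl// addnC.
by rewrite /F subnK// (leq_trans _ nN)// leq_addl.
Unshelve. all: by end_near. Qed.

End BorelCantelli.

(** * Pathwise convergence *)

(** Pairs with large kn obey the bound, and [al] is monotone; the finitely many other pairs have a
    common bound, which [al] eventually exceeds. *)
Lemma dlim_positive_part (R : realType) (T : Type) (X : nat -> nat -> T -> R)
    (w : T) (al : nat -> R) :
  (forall M N, (0 < M)%N -> (M <= N)%N -> al M <= al N) ->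
  (forall K, exists N0, forall N, (N0 <= N)%N -> K <= al N) ->
  (forall e, 0 < e -> exists N0, forall k n, (0 < k)%N -> (0 < n)%N ->
     (N0 <= k * n)%N -> X k n w <= al (k * n)%N + e) ->
  dlim (fun m j => Num.max (max_array X m j w - al (m * j)%N) 0) 0.
Proof.
move=> al_le al_oo Xal eps eps0; have e2 : 0 < eps / 2 by lra.
have [N1 hN1] := Xal _ e2.
(* For k, n >= 1, kn < N1 forces k, n < N1, so this box contains every exceptional pair. *)
pose K := \big[Num.max/0]_(k < N1) \big[Num.max/0]_(n < N1) X k n w.
have [N2 hN2] := al_oo K; exists N2 => m j m0 j0 N2mj.
have mj : (maxn m j <= m * j)%N by rewrite geq_max leq_pmulr// leq_pmull.
have bound k n : (0 < k <= m)%N -> (0 < n <= j)%N -> X k n w <= al (m * j)%N + eps / 2.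
  move=> /andP[k0 km] /andP[n0 nj].
  have knmj : (k * n <= m * j)%N by exact: leq_mul.
  have [/hN1 h|knN1] := leqP N1 (k * n).
    by apply: le_trans (h k0 n0) _; rewrite lerD2r al_le// muln_gt0 k0.
  have kN1 : (k < N1)%N by apply: leq_ltn_trans knN1; rewrite leq_pmulr.
  have nN1 : (n < N1)%N by apply: leq_ltn_trans knN1; rewrite leq_pmull.
  have XK : X k n w <= K.
    apply: le_trans (le_bigmax _ (fun n : 'I_N1 => X k n w) (Ordinal nN1)) _.
    exact: (le_bigmax _ (fun k : 'I_N1 => \big[Num.max/0]_(n < N1) X k n w) (Ordinal kN1)).
  have := hN2 (m * j)%N (leq_trans N2mj mj); lra.
(* The default value of the maxima in [max_array] has to obey the bound too. *)
have b11 : X 1%N 1%N w <= al (m * j)%N + eps / 2 by apply: bound; rewrite ?m0 ?j0.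
have : max_array X m j w <= al (m * j)%N + eps / 2.
  rewrite /max_array big_nat_cond; apply: bigmax_le => // k /andP[km _].
  by rewrite big_nat_cond; apply: bigmax_le => // n /andP[nj _]; exact: bound.
rewrite subr0 => h; rewrite ger0_norm; last by rewrite le_max lexx orbT.
by rewrite gt_max eps0 andbT; lra.
Qed.

(** * Exceedances of the array, grouped by the product kn *)

Section Array.
Variables (R : realType) (d : measure_display) (T : measurableType d).
Variables (P : probability T R) (phi p g : R -> R).
Variable X : nat -> nat -> {mfun T >-> R}.
Hypotheses (Nphi : N_function phi) (dphi : is_density phi p).
Hypothesis subX :
  forall k n, (0 < k)%N -> (0 < n)%N -> subgaussian P phi (X k n).
Hypothesis g_gt0 : forall x, 0 <= x -> 0 < g x.
Hypothesis g_le : forall x y, 0 <= x -> x <= y -> g x <= g y.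
Hypothesis tauX : forall k n, (0 < k)%N -> (0 < n)%N ->
  tau P phi (X k n) <= g (ln (k%:R * n%:R)).
Local Notation q := (gen_inv p).
Local Notation psi := (young phi).

(** The level a_{m,j} depends on (m, j) only through N = mj. *)
Let threshold (N : nat) := g (ln N%:R) * inv_pos psi (ln N%:R).

Let ln_nat_ge0 (N : nat) : (0 < N)%N -> 0 <= ln N%:R :> R.
Proof. by move=> N0; rewrite ln_ge0// ler1n. Qed.

Let ln_nat_le (M N : nat) : (0 < M)%N -> (M <= N)%N -> ln M%:R <= ln N%:R :> R.
Proof.
by move=> M0 MN; rewrite ler_ln ?posrE ?ltr0n ?ler_nat// (leq_trans M0).
Qed.

Lemma threshold_le M N : (0 < M)%N -> (M <= N)%N -> threshold M <= threshold N.
Proof.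
move=> M0 MN; have lM := ln_nat_ge0 _ M0; have lMN := ln_nat_le _ _ M0 MN.
apply: ler_pM; [exact/ltW/g_gt0|exact: inv_pos_ge0 Nphi dphi _ lM|exact: g_le|].
exact: inv_pos_le Nphi dphi _ _ lM lMN.
Qed.

(** With x = |K| / g(0), once ln N >= psi(x) the inverse is at least x, and g(ln N) >= g(0). *)
Lemma threshold_unbounded K :
  exists N0, forall N, (N0 <= N)%N -> K <= threshold N.
Proof.
have g0 := g_gt0 0 (lexx _).
pose x := `|K| / g 0; have x0 : 0 <= x by rewrite divr_ge0// ltW.
exists (Num.truncn (expR (psi x))).+1 => N hN.
have N0 : (0 < N)%N by exact: leq_trans hN.
have lN := ln_nat_ge0 _ N0.
have psiN : psi x <= ln N%:R.
  rewrite -ler_expR lnK ?posrE ?ltr0n//; apply: ltW.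
  by apply: lt_le_trans (truncnS_gt _) _; rewrite ler_nat.
apply: le_trans (ler_norm K) _; rewrite (_ : `|K| = g 0 * x); last first.
  by rewrite /x mulrC divfK// gt_eqF.
apply: ler_pM => //; [exact: ltW|exact: g_le|].
exact: le_inv_pos Nphi dphi _ _ lN x0 psiN.
Qed.

(** The event of the pair (k, N / k), empty unless k is a positive divisor of N; the union over k <=
    N then runs over all pairs of product N. *)
Let exceed e (N k : nat) : set T :=
  if (0 < k)%N && (k %| N)%N then [set w | threshold N + e <= X k (N %/ k)%N w]
  else set0.

Let exceeds e N : set T := \big[setU/set0]_(k < N.+1) exceed e N k.

Let measurable_exceed e N k : measurable (exceed e N k).
Proof.
rewrite /exceed; case: ifP => // _; rewrite -[X in measurable X]setTI.
rewrite (_ : [set w | _] = X k (N %/ k)%N @^-1` `[threshold N + e, +oo[%classic).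
  exact: measurable_funPT.
by apply/seteqP; split => w /=; rewrite in_itv/= andbT.
Qed.

(** Union bound over the d(N) pairs, each with the tail bound at v = ln N, whose factor exp(-v) is
    1/N; N > 1 makes v positive. *)
Let exceeds_le e N : (1 < N)%N ->
  (P (exceeds e N) <= ((ndiv N)%:R / N%:R *
     expR (- (e * q (inv_pos psi (ln N%:R))) / g (ln N%:R)))%:E)%E.
Proof.
move=> N1; set c := expR _; have N0 : (0 < N)%N by exact: ltnW.
apply: le_trans (Boole_inequality _ _) _ => //.
apply: (@le_trans _ _ (\sum_(k < N.+1)
    (((0 < k)%N && (k %| N)%N)%:R * (N%:R^-1 * c))%:E)%E); last first.
  by rewrite sumEFin lee_fin -mulr_suml -natr_sum mulrA.
apply: lee_sum => k _; rewrite /exceed; case: ifP => [/andP[k0 kN]|_]; last first.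
  by rewrite measure0 mul0r.
have Nk0 : (0 < N %/ k)%N by rewrite divn_gt0// dvdn_leq.
have lnN : ln (k%:R * (N %/ k)%:R) = ln N%:R :> R by rewrite -natrM mulnC divnK.
rewrite mul1r; apply: le_trans (subgaussian_tail _ _ _ Nphi dphi _ _ _ _ _ _ _
  (subX k (N %/ k) k0 Nk0) _ _ _) _.
- by rewrite -lnN; exact: tauX.
- by apply: g_gt0; exact: ln_nat_ge0.
- by rewrite ln_gt0// ltr1n.
by rewrite lee_fin expRN lnK// posrE ltr0n.
Qed.

Lemma array_eventually_le e : 0 < e ->
  (\int[lebesgue_measure]_(x in `[0%R, +oo[)
     (psi x * q x * expR (- (e * q x) / g (psi x + ln 2)))%:E < +oo)%E ->
  {ae P, forall w, exists N0, forall k n, (0 < k)%N -> (0 < n)%N ->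
     (N0 <= k * n)%N -> X k n w <= threshold (k * n) + e}.
Proof.
move=> e0 fin.
have [K hK] := tail_series_bounded _ _ _ Nphi dphi _ g_gt0 g_le e (ltW e0) fin.
have : {ae P, forall w, exists N0, forall N, (N0 <= N)%N -> ~ exceeds e N w}.
  apply: (Borel_Cantelli_eventually _ _ _ _ _ 4 K).
    by move=> N; apply: bigsetU_measurable => k _; exact: measurable_exceed.
  move=> M; apply: (@le_trans _ _ (\sum_(4 <= N < M) ((ndiv N)%:R / N%:R *
     expR (- (e * q (inv_pos psi (ln N%:R))) / g (ln N%:R)))%:E)%E).
    rewrite big_nat_cond [leRHS]big_nat_cond; apply: lee_sum => N /andP[/andP[N4 _] _].
    by apply: exceeds_le; exact: leq_trans N4.
  by rewrite sumEFin lee_fin.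
apply: filterS => w [N0 hN0]; exists N0 => k n k0 n0 /hN0 nexc.
rewrite leNgt; apply/negP => /ltW Xw; apply: nexc.
have kkn : (k < (k * n).+1)%N by rewrite ltnS leq_pmulr.
rewrite /exceeds -(bigcup_mkord (k * n).+1 (exceed e (k * n))).
by exists k => //=; rewrite /exceed k0 dvdn_mulr//= mulKn.
Qed.

End Array.

(** * Almost sure convergence, from countably many tolerances *)

Theorem theorem1 (R : realType) (d : measure_display) (T : measurableType d)
  (P : probability T R) (phi p : R -> R) (g : R -> R)
  (X : nat -> nat -> {mfun T >-> R}) :
  N_function phi ->
  is_density phi p ->
  (forall k n, (0 < k)%N -> (0 < n)%N -> subgaussian P phi (X k n)) ->
  (forall x, 0 <= x -> 0 < g x) ->
  (forall x y, 0 <= x -> x <= y -> g x <= g y) ->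
  (forall k n, (0 < k)%N -> (0 < n)%N ->
     tau P phi (X k n) <= g (ln (k%:R * n%:R))) ->
  (exists eps0 : R, 0 < eps0 /\ forall eps, 0 < eps -> eps <= eps0 ->
     (\int[lebesgue_measure]_(x in `[0%R, +oo[)
        (young phi x * gen_inv p x *
         expR (- (eps * gen_inv p x) / g (young phi x + ln 2)))%:E < +oo)%E) ->
  let a := fun m j : nat => g (ln (m%:R * j%:R)) *
                            inv_pos (young phi) (ln (m%:R * j%:R)) in
  {ae P, forall w, dlim (fun m j =>
      Num.max (max_array (fun k n => X k n) m j w - a m j) 0) 0}.
Proof.
move=> Nphi dphi subX g_gt0 g_le tauX [eps0 [eps0_gt0 fin]] a.
(* Countably many tolerances, all at most [eps0], so that one null set serves them all. *)
pose e (i : nat) := eps0 / i.+1%:R.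
have e_gt0 i : 0 < e i by rewrite divr_gt0.
have e_le i : e i <= eps0 by rewrite ler_pdivrMr// ler_peMr ?ler1n// ltW.
have : {ae P, forall w i, exists N0, forall k n, (0 < k)%N -> (0 < n)%N ->
    (N0 <= k * n)%N -> X k n w <= g (ln (k * n)%:R) *
      inv_pos (young phi) (ln (k * n)%:R) + e i}.
  apply: ae_foralln => i; apply: (array_eventually_le _ _ _ P phi p g X) => //.
  exact: fin.
apply: filterS => w hw.
pose al (N : nat) := g (ln N%:R) * inv_pos (young phi) (ln N%:R).
rewrite (_ : (fun m j => _) = fun m j : nat =>
  Num.max (max_array (fun k n => X k n) m j w - al (m * j)%N) 0); last first.
  by apply/funext => m; apply/funext => j; rewrite /al natrM.
apply: (dlim_positive_part _ _ (fun k n => X k n)).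
- exact: threshold_le Nphi dphi g_gt0 g_le.
- exact: threshold_unbounded Nphi dphi g_gt0 g_le.
(* This index makes eps0 / (i + 1) smaller than [eps]. *)
move=> eps eps_gt0; pose i := Num.truncn (eps0 / eps).
have [N0 hN0] := hw i; exists N0 => k n k0 n0 kn.
apply: le_trans (hN0 k n k0 n0 kn) _; rewrite lerD2l /e ler_pdivrMr//.
by rewrite mulrC -ler_pdivrMr// ltW// truncnS_gt.
Qed.
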